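(* Let $$f(x_1, \dots, x_n) = \bigl(h_1(x_1),\, h_2(x_1, x_2),\, \dots,\, h_n(x_1, x_2, \dots, x_n)\bigr)$$ be a self-homeomorphism of the $n$-dimensional torus $\mathbb{T}^n$ that preserves the Haar measure, where $h_1$ is a measure-preserving self-homeomorphism of the circle $\mathbb{T}$ and $h_j$ is a function from $\mathbb{T}^j$ to $\mathbb{T}$ for $2 \le j \le n$. Then there exist $\alpha \in [0,1)$, continuous functions $g_1, \dots, g_{n-1}$ from $\mathbb{T}, \mathbb{T}^2, \dots, \mathbb{T}^{n-1}$ respectively to $\mathbb{T}$, and a choice of constant signs $\varepsilon_1, \dots, \varepsilon_n \in \{1, -1\}$ such that for all $(x_1, \dots, x_n) \in \mathbb{T}^n$, $$f(x_1, \dots, x_n) = \bigl(\varepsilon_1 x_1 + \alpha,\, \varepsilon_2 x_2 + g_1(x_1),\, \dots,\, \varepsilon_n x_n + g_{n-1}(x_1, \dots, x_{n-1})\bigr).$$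
   Context: $\mathbb{T} = \mathbb{R}/\mathbb{Z}$ is the circle group, written additively, and $\mathbb{T}^n$ is the product of $n$ copies of $\mathbb{T}$; numbers $\alpha \in [0,1)$ are identified with their classes in $\mathbb{R}/\mathbb{Z}$. A homeomorphism $f$ preserves a measure $\mu$ if $\mu(f^{-1}(B)) = \mu(B)$ for every Borel set $B$; ''measure-preserving'' on $\mathbb{T}$ refers to the Haar measure of $\mathbb{T}$. *)

(* Defs.v *)
From HB Require Import structures.
From mathcomp Require Import all_boot all_order all_algebra.
From mathcomp Require Import generic_quotient ring_quotient.
From mathcomp Require Import all_classical all_reals all_analysis.

Set Implicit Arguments.
Unset Strict Implicit.
Unset Printing Implicit Defensive.

Import Order.TTheory GRing.Theory Num.Theory.
Import numFieldNormedType.Exports.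

Local Open Scope classical_set_scope.
Local Open Scope ring_scope.
Local Open Scope quotient_scope.

Definition integers (R : realType) : zmodClosed R :=
  GRing.ZmodClosed.clone R (@Num.int_num_subdef R) _.

(** The quotient group of the additive group R by the subgroup of integers,
    with the quotient topology. *)
Definition circle (R : realType) : Type :=
  quotient_topology (Quotient.quot (integers R)).

HB.instance Definition _ (R : realType) := PointedTopological.copy (circle R)
  (quotient_topology (Quotient.quot (integers R))).
HB.instance Definition _ (R : realType) := GRing.isZmodule.Build (circle R)
  (@Quotient.addqA R (integers R)) (@Quotient.addqC R (integers R))
  (@Quotient.add0q R (integers R)) (@Quotient.addNq R (integers R)).

Definition to_circle (R : realType) (a : R) : circle R :=
  \pi_(Quotient.quot (integers R)) a.

(** The topology on row vectors is the product topology and their addition is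
    coordinatewise. *)
Notation torus R n := 'rV[circle R]_n.

Notation borel G := (g_sigma_algebraType (@open G)).

(** [mu] is the Haar measure, of total mass 1, of the compact abelian group
    with underlying space [G] and group law [add]. On the second countable
    compact groups [circle R] and [torus R n] every Borel probability measure
    is regular, so regularity is not required separately. *)
Definition is_haar (R : realType) (G : ptopologicalType) (add : G -> G -> G)
    (mu : probability (borel G) R) : Prop :=
  forall (a : G) (B : set (borel G)), measurable B ->
    mu [set add a x | x in B] = mu B.

Definition preserves (R : realType) (X : ptopologicalType)
    (mu : probability (borel X) R) (f : X -> X) : Prop :=
  forall B : set (borel X), measurable B -> mu (f @^-1` B) = mu B.

Definition homeomorphism (X Y : topologicalType) (f : X -> Y) : Prop :=
  continuous f /\
  exists g : Y -> X, [/\ continuous g, cancel f g & cancel g f].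

Definition first_coords (T : Type) (k n : nat) (le_kn : (k <= n)%N)
    (x : 'rV[T]_n) : 'rV[T]_k :=
  colsub (widen_ord le_kn) x.

(* Main.v *)
Require Import Defs.
From HB Require Import structures.
From mathcomp Require Import all_boot all_order all_algebra.
From mathcomp Require Import finmap all_classical all_reals all_analysis.
From mathcomp Require Import ring lra.

Set Implicit Arguments.
Unset Strict Implicit.
Unset Printing Implicit Defensive.

Import Order.TTheory GRing.Theory Num.Theory.
Import numFieldNormedType.Exports.

Local Open Scope classical_set_scope.
Local Open Scope ring_scope.

(** The idea is to move one coordinate at a time. Coordinate [j] of [f x] depends
    only on the coordinates of [x] of index at most [j]; freezing all of them but
    the last one gives a continuous self-map [fibre f x j] of the circle, and the
    claim is that it has the form [t |-> t + c] or [t |-> - t + c], with a sign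
    that does not depend on [x]. The translation part [c], the value of the fibre
    map at [0], is then a continuous function of the preceding coordinates.

    Topology gives injectivity. The homeomorphism [f] is injective, and
    injectivity descends to the maps induced on the first coordinates
    ([agree_from_image]): two different points with the same image would have
    fibre maps which are injective with disjoint images, but a continuous
    injective self-map of the circle is surjective ([circle_inj_surj]). Hence the
    fibre maps are injective ([fibre_inj]), and the inverse of [f] is triangular
    ([agree_g]).

    Measure gives a metric property. For a cylinder [V] in coordinate [j], the set
    of the points of [V] whose coordinate [j] lies in an arc has for measure the
    length of the arc times the measure of [V] ([mu_slab]); this follows from the
    invariance under translations, without any disintegration. If a fibre map
    contracted an arc, then so would, with the same bound, the neighbouring fibre
    maps, and [f] would decrease the measure of a slab over a small open
    cylinder. So the fibre maps do not contract arcs ([fibre_expanding]).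

    These two properties leave only isometries ([expanding_injective_isometry]):
    cut at a point, an injective circle map is a monotone function from an
    interval of length 1 to itself, with slopes of absolute value at least 1. The
    sign is constant because the torus is connected ([fibre_sign_constant]). *)

(** * The circle as the reals modulo the integers *)

(** Locked because unfolding exposes a difference, which the rewriting lemmas
    on subtraction would otherwise match. *)
HB.lock Definition fpart (R : realType) (t : circle R) : R :=
  repr t - (Num.floor (repr t))%:~R.

Section Circle.
Variable R : realType.
Implicit Types (x y : R) (t c : circle R).

Lemma to_circleD x y : to_circle (x + y) = to_circle x + to_circle y.
Proof. exact: Quotient.pi_add. Qed.

Lemma to_circleN x : to_circle (- x) = - to_circle x.
Proof. exact: Quotient.pi_opp. Qed.

Lemma to_circle0 : to_circle (0 : R) = 0.
Proof. by apply: (addrI (to_circle 0)); rewrite -to_circleD !addr0. Qed.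

Lemma to_circleB x y : to_circle (x - y) = to_circle x - to_circle y.
Proof. by rewrite to_circleD to_circleN. Qed.

Lemma eq_to_circle x y : (to_circle x = to_circle y) <-> (x - y \is a Num.int).
Proof.
have E : (x - y \in integers R) = (x - y \is a Num.int) by [].
rewrite -E Quotient.idealrBE; split=> [|/eqP//].
by move=> h; apply/eqP.
Qed.

Lemma to_circle_int x : x \is a Num.int -> to_circle x = 0.
Proof. by move=> xi; rewrite -to_circle0; apply/eq_to_circle; rewrite subr0. Qed.

Lemma fpartK t : to_circle (fpart t) = t.
Proof.
rewrite fpart.unlock to_circleB (@to_circle_int (_%:~R)) ?intr_int// subr0.
exact: reprK.
Qed.

Lemma fpart_ge0 t : 0 <= fpart t.
Proof. by rewrite fpart.unlock subr_ge0 floor_le. Qed.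

Lemma fpart_lt1 t : fpart t < 1.
Proof. by rewrite fpart.unlock ltrBlDr addrC -intrD1 floorD1_gt. Qed.

Lemma to_circleK x : 0 <= x < 1 -> fpart (to_circle x) = x.
Proof.
move=> /andP[x0 x1].
have /eq_to_circle /intrP[k e] := fpartK (to_circle x).
have := fpart_ge0 (to_circle x); have := fpart_lt1 (to_circle x).
move=> f1 f0.
have k0 : k = 0.
  apply/eqP; rewrite eq_le -(ltzD1 k) -(ltzD1 0).
  rewrite -!(@ltr_int R) intrD -e.
  by apply/andP; split; lra.
by move/eqP: e; rewrite k0 subr_eq0 => /eqP.
Qed.

Lemma fpart0 : fpart (0 : circle R) = 0.
Proof. by rewrite -to_circle0 to_circleK// lexx ltr01. Qed.

Lemma fpart_gt0 t : t != 0 -> 0 < fpart t.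
Proof.
rewrite lt_neqAle fpart_ge0 andbT; apply: contra_neq => h.
by rewrite -(fpartK t) -h to_circle0.
Qed.

Lemma fpart_shift t x : 0 <= fpart t + x < 1 -> fpart (t + to_circle x) = fpart t + x.
Proof. by move=> h; rewrite -{1}(fpartK t) -to_circleD to_circleK. Qed.

(** The projection of the reals onto the circle is open, so the translates of
    images of small intervals form a basis of neighbourhoods. *)
Lemma nbhs_circleP t (A : set (circle R)) :
  nbhs t A <-> exists2 e : R, 0 < e & forall x, `|x| < e -> A (t + to_circle x).
Proof.
split.
  move=> At; have : nbhs (fpart t) ((@to_circle R) @^-1` A).
    by apply: (@pi_continuous R (Quotient.quot (integers R))); rewrite /= -/(to_circle _) fpartK.
  move=> /nbhs_ballP[e /= e0 he]; exists e => // x xe.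
  rewrite -(fpartK t) -to_circleD; apply: he.
  by rewrite /ball/= opprD addrA subrr sub0r normrN.
move=> [e e0 he].
pose B := [set t + to_circle x | x in [set x | `|x| < e]].
rewrite nbhsE; exists B; last by move=> _ [x xe <-]; exact: he.
split; last by exists 0; rewrite /= ?normr0// to_circle0 addr0.
rewrite /open/= /quotient_open.
rewrite openE => y /= [x xe]; rewrite -/(to_circle _) => hx.
apply/nbhs_ballP; exists (e - `|x|); rewrite /= ?subr_gt0// => z.
rewrite /ball/= => yz; exists (x + (z - y)) => /=.
  by rewrite (le_lt_trans (ler_normD _ _))// addrC -ltrBrDr distrC.
by rewrite -/(to_circle _) to_circleD addrA hx -to_circleD addrC subrK.
Qed.
End Circle.

(** * Topology of the circle *)

Section CircleTopology.
Variable R : realType.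
Implicit Types (t c : circle R).

Lemma continuous_to_circle : continuous (@to_circle R).
Proof. exact: (@pi_continuous R (Quotient.quot (integers R))). Qed.

Lemma continuous_circleD (X : topologicalType) (f g : X -> circle R) (x : X) :
  {for x, continuous f} -> {for x, continuous g} ->
  {for x, continuous (fun y => f y + g y)}.
Proof.
move=> fx gx A /nbhs_circleP[e e0 he]; rewrite /= in he.
have e20 : 0 < e / 2 by rewrite divr_gt0.
have fA : nbhs (f x) [set f x + to_circle y | y in [set y | `|y| < e / 2]].
  by apply/nbhs_circleP; exists (e / 2) => // y ye; exists y.
have gA : nbhs (g x) [set g x + to_circle y | y in [set y | `|y| < e / 2]].
  by apply/nbhs_circleP; exists (e / 2) => // y ye; exists y.
change (nbhs x [set y | A (f y + g y)]).
have fxA : nbhs x (f @^-1` _) := fx _ fA.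
have gxA : nbhs x (g @^-1` _) := gx _ gA.
apply: (@filterS2 _ (nbhs x) _ _ _ _ _ fxA gxA) => y /= [u ue <-] [v ve <-].
rewrite addrACA -to_circleD; apply: he.
by rewrite (le_lt_trans (ler_normD _ _))// (splitr e) ltrD.
Qed.

Lemma continuous_circleN (X : topologicalType) (f : X -> circle R) (x : X) :
  {for x, continuous f} -> {for x, continuous (fun y => - f y)}.
Proof.
move=> fx A /nbhs_circleP[e e0 he].
change (nbhs x (f @^-1` [set t | A (- t)])); apply: (fx [set t | A (- t)]).
apply/nbhs_circleP.
exists e => // y ye; rewrite /= opprD -to_circleN; apply: he.
by rewrite normrN.
Qed.

Lemma continuous_circleB (X : topologicalType) (f g : X -> circle R) (x : X) :
  {for x, continuous f} -> {for x, continuous g} ->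
  {for x, continuous (fun y => f y - g y)}.
Proof.
by move=> fx gx; apply: continuous_circleD => //; exact: continuous_circleN.
Qed.

(** The fractional part jumps only at the class of the integers. *)
Lemma continuous_fpart t : t != 0 -> {for t, continuous (@fpart R)}.
Proof.
move=> /fpart_gt0 t0 A /nbhs_ballP[e /= e0 he].
have t1 := fpart_lt1 t.
apply/nbhs_circleP; exists (Num.min e (Num.min (fpart t) (1 - fpart t))).
  by rewrite !lt_min e0 t0 subr_gt0.
move=> x; rewrite !lt_min => /and3P[xe xt xt1] /=; rewrite fpart_shift.
  by apply: he; rewrite /ball/= opprD addrA subrr sub0r normrN.
by move: xt xt1; rewrite !ltr_norml; lra.
Qed.

Lemma open_fpart_gt (a : R) : 0 <= a -> open [set t : circle R | a < fpart t].
Proof.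
move=> a0; rewrite openE => t /= at_.
have t0 : t != 0.
  by apply: contraTneq at_ => ->; rewrite fpart0 -leNgt.
by have /(_ [set x | a < x]) := continuous_fpart t0; apply; exact: lt_nbhsr.
Qed.

Lemma open_fpart_lt (a b : R) :
  0 <= a -> open [set t : circle R | a < fpart t < b].
Proof.
move=> a0; rewrite openE => t /= /andP[at_ tb].
have t0 : t != 0.
  by apply: contraTneq at_ => ->; rewrite fpart0 -leNgt.
have /(_ [set x | a < x < b]) := continuous_fpart t0; apply.
apply: filterS2 (lt_nbhsr at_) (lt_nbhsl tb) => x /= ax xb.
by rewrite ax xb.
Qed.

(** If a value [p] were missed, [fpart (phi t - p)] would be a continuous
    injective real function of [t]. Subtracting it from its translate by half a
    turn gives a function that changes sign under that half turn, hence has a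
    zero: two antipodal points with the same image. *)
Lemma circle_inj_surj (phi : circle R -> circle R) :
  continuous phi -> injective phi -> forall p, exists t, phi t = p.
Proof.
move=> cphi iphi p; apply: contrapT => np.
have nz t : phi t - p != 0.
  by apply/eqP => /subr0_eq e; apply: np; exists t.
pose u t := fpart (phi t - p).
have cu : continuous u.
  move=> t; apply: (continuous_comp (f := fun t => phi t - p)); last exact: continuous_fpart.
  by apply: continuous_circleB; [exact: cphi | exact: cst_continuous].
pose d (x : R) := u (to_circle (x + 2^-1)) - u (to_circle x).
have cd : continuous d.
  move=> x; apply: (@cvgB R R^o).
    apply: (continuous_comp (f := fun x : R => to_circle (x + 2^-1))); last exact: cu.
    apply: (continuous_comp (f := fun x : R => (x + 2^-1))); last exact: continuous_to_circle.
    by apply: (@cvgD R R^o); [exact: cvg_id | exact: cvg_cst].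
  by apply: continuous_comp; [exact: continuous_to_circle | exact: cu].
have d2 : d 2^-1 = - d 0.
  rewrite /d add0r opprB (_ : to_circle (_ + _) = to_circle 0)//.
 by apply/eq_to_circle; rewrite subr0 (_ : _ + _ = 1 :> R)// ; lra.
have [|||c _ dc] := @IVT R d 0 2^-1 0.
  by [].
  exact: continuous_subspaceT.
  rewrite d2; have [d0|d0] := leP 0 (d 0).
    by rewrite ge_min le_max oppr_le0 d0 orbT.
  by rewrite ge_min le_max (ltW d0) oppr_ge0 (ltW d0) orbT.
have /(congr1 (fun t => t + p)) : phi (to_circle (c + 2^-1)) - p = phi (to_circle c) - p.
  by rewrite -[LHS]fpartK -[RHS]fpartK; congr to_circle; apply/eqP; rewrite -subr_eq0 -/(d c) dc.
rewrite !subrK => /iphi /eq_to_circle; rewrite addrAC subrr add0r.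
move=> /intrP[k e].
have : (0 < k%:~R :> R) && (k%:~R < 1 :> R) by rewrite -e; lra.
by rewrite (ltr_int R 0) (ltr_int R _ 1); case: k {e} => [[|k]|k].
Qed.

End CircleTopology.

(** * Circle maps that do not contract arcs *)

Section CircleRigidity.
Variable R : realType.

(** Arcs are not contracted: an image contained in an open arc of length
    [be - al] comes from an arc of length at most [be - al]. The base point [c]
    only serves to place the target arc within the range of [fpart]. *)
Definition expanding (phi : circle R -> circle R) := forall c (a b al be : R),
  0 <= a -> a <= b -> b < 1 -> 0 <= al -> al <= be -> be < 1 ->
  (forall s, a <= s <= b -> al < fpart (phi (to_circle s) - c) < be) ->
  b - a <= be - al.

(** Away from [0], injectivity keeps [phi t - phi 0] away from [0], so its
    fractional part [u] is a continuous injective, hence monotone, function from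
    ]0, 1[ to ]0, 1[. Being expanding, [u] has slopes of absolute value at
    least 1, and no such function fits in an interval of length 1 other than
    [s] and [1 - s]. *)
Lemma expanding_injective_isometry (phi : circle R -> circle R) :
  continuous phi -> injective phi -> expanding phi ->
  (forall t, phi t = t + phi 0) \/ (forall t, phi t = - t + phi 0).
Proof.
move=> cphi iphi ephi.
pose u (s : R) := fpart (phi (to_circle s) - phi 0).
have nz s : 0 < s < 1 -> phi (to_circle s) - phi 0 != 0.
  move=> s01; apply/eqP => /subr0_eq /iphi e.
  case/andP: s01 => s0 s1; have := @to_circleK R s.
  by rewrite e fpart0 s1 ltW// => /(_ isT) se; rewrite -se ltxx in s0.
have u0 s : 0 < s < 1 -> 0 < u s by move=> /nz; exact: fpart_gt0.
have u1 s : u s < 1 by exact: fpart_lt1.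
have mono : {in `]0, 1[%R &, {homo u : x y / x < y}} \/
    {in `]0, 1[%R &, {homo u : x y /~ x < y}}.
  apply: itv_continuous_inj_mono.
    apply: continuous_in_subspaceT => s; rewrite inE/= in_itv/= => s01.
    apply: (continuous_comp (f := fun s => phi (to_circle s) - phi 0)); last first.
      exact: continuous_fpart (nz _ s01).
    apply: continuous_circleB; last exact: cst_continuous.
    by apply: continuous_comp; [exact: continuous_to_circle | exact: cphi].
  move=> s t; rewrite !in_itv/= => /andP[s0 s1] /andP[t0 t1].
  move=> /(congr1 (@to_circle R)); rewrite !fpartK => /addIr /iphi.
  by move=> /(congr1 (@fpart R)); rewrite !to_circleK// ltW.
have exp a b m M : 0 < a -> a < b -> b < 1 -> 0 < m -> M < 1 ->
    (forall s, a <= s <= b -> m <= u s <= M) -> b - a <= M - m.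
  move=> a0 ab b1 m0 M1 H; rewrite leNgt; apply/negP => lt.
  have /andP[mu_ uM] : m <= u a <= M by apply: H; rewrite lexx ltW.
  (* The margin [d] keeps the open arc ]m - d, M + d[ inside ]0, 1[ and still
     shorter than [a, b]. *)
  pose d := Num.min ((b - a - (M - m)) / 3) (Num.min m (1 - M)) / 2.
  have d0 : 0 < d by rewrite divr_gt0// !lt_min; do ?[apply/andP; split]; lra.
  have [d1 d2 d3] : [/\ 2 * d <= (b - a - (M - m)) / 3, 2 * d <= m & 2 * d <= 1 - M].
    rewrite /d mulrC -mulrA mulVf// mulr1.
    by split; rewrite !ge_min lexx ?orbT.
  have := @ephi (phi 0) a b (m - d) (M + d).
  have H' s : a <= s <= b -> m - d < u s < M + d.
    by move=> /H /andP[? ?]; apply/andP; split; lra.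
  move=> /(_ _ _ _ _ _ _ H'); suff : M + d - (m - d) < b - a by lra.
  by lra.
case: mono => mono; [left|right] => t.
  have umono x y : 0 < x -> x <= y -> y < 1 -> u x <= u y.
    rewrite [x <= y]le_eqVlt => x0 /predU1P[->//|xy] y1.
    by apply/ltW/mono => //; rewrite in_itv/=; apply/andP; split; lra.
  have uexp x y : 0 < x -> x < y -> y < 1 -> y - x <= u y - u x.
    move=> x0 xy y1; apply: exp => //; first by apply: u0; apply/andP; split; lra.
    by move=> s /andP[xs sy]; rewrite !umono//; lra.
  have uid s : 0 < s < 1 -> u s = s.
    move=> /andP[s0 s1]; have us0 : 0 < u s by apply: u0; rewrite s0.
    have us1 := u1 s.
    (* If [u s < s], the slope bound already fails between a point close to
       [0] and [s], since [u] is positive; if [u s > s], it fails between [s]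
       and a point close to [1], since [u] is less than 1. *)
    have := @uexp ((s - u s) / 2) s; have := @uexp s (1 - (u s - s) / 2).
    have := u1 (1 - (u s - s) / 2).
    have [lt|lt|//] := ltgtP (u s) s.
      have p0 : 0 < u ((s - u s) / 2) by apply: u0; apply/andP; split; lra.
      by move=> _ _ /(_ _ _ s1) H; have := H; lra.
    by move=> p1 /(_ s0) H _; have := H; lra.
  have [->|t0] := eqVneq t 0; first by rewrite add0r.
  have t01 : 0 < fpart t < 1 by rewrite fpart_gt0// fpart_lt1.
  have := congr1 (@to_circle R) (uid _ t01).
  by rewrite /u !fpartK => /eqP; rewrite subr_eq => /eqP.
have umono x y : 0 < x -> x <= y -> y < 1 -> u y <= u x.
  rewrite [x <= y]le_eqVlt => x0 /predU1P[->//|xy] y1.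
  by apply/ltW/mono => //; rewrite in_itv/=; apply/andP; split; lra.
have uexp x y : 0 < x -> x < y -> y < 1 -> y - x <= u x - u y.
  move=> x0 xy y1; apply: exp => //; first by apply: u0; apply/andP; split; lra.
  by move=> s /andP[xs sy]; rewrite !umono//; lra.
have uid s : 0 < s < 1 -> u s = 1 - s.
  move=> /andP[s0 s1]; have us0 : 0 < u s by apply: u0; rewrite s0.
  have us1 := u1 s.
  have := @uexp ((u s - (1 - s)) / 2) s; have := @uexp s (1 - (1 - s - u s) / 2).
  have := u1 ((u s - (1 - s)) / 2).
  have [lt|lt|//] := ltgtP (u s) (1 - s).
    have p0 : 0 < u (1 - (1 - s - u s) / 2) by apply: u0; apply/andP; split; lra.
    by move=> _ /(_ s0) H _; have := H; lra.
  by move=> p1 _ /(_ _ _ s1) H; have := H; lra.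
have [->|t0] := eqVneq t 0; first by rewrite oppr0 add0r.
have t01 : 0 < fpart t < 1 by rewrite fpart_gt0// fpart_lt1.
have := congr1 (@to_circle R) (uid _ t01).
rewrite /u to_circleB !fpartK to_circle_int ?rpred1// sub0r.
by move=> /eqP; rewrite subr_eq => /eqP.
Qed.
End CircleRigidity.

(** * Topology of the torus and positivity of its Haar measure *)

Section TorusTopology.
Variables (R : realType) (n : nat).
Implicit Types (z w : torus R n) (i j : 'I_n) (t : circle R).

Lemma continuous_coord j : continuous (fun z => z 0 j).
Proof.
move=> z A zA; exists (fun _ k => if k == j then A else setT).
  by move=> i k; rewrite (ord1 i); case: eqP => [->|_]; [exact: zA | exact: filterT].
by move=> w /(_ 0 j); rewrite eqxx.
Qed.

Lemma continuous_torus (X : topologicalType) (g : X -> torus R n) (a : X) :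
  (forall j, {for a, continuous (fun y => g y 0 j)}) -> {for a, continuous g}.
Proof.
move=> cg A [P nP PA]; change (nbhs a (g @^-1` A)).
have : nbhs a [set y | forall j, P 0 j (g y 0 j)].
  by apply: filter_forall => j; exact: (cg j _ (nP 0 j)).
by apply: filterS => y Py; apply: PA => i j; rewrite (ord1 i).
Qed.

Definition upd z j t : torus R n := \row_i (if i == j then t else z 0 i).

Lemma updE z j t i : upd z j t 0 i = if i == j then t else z 0 i.
Proof. by rewrite mxE. Qed.

Lemma upd_id z j : upd z j (z 0 j) = z.
Proof. by apply/rowP => i; rewrite updE; case: eqP => [->|]. Qed.

Lemma continuous_upd (X : topologicalType) (g : X -> torus R n) j
    (h : X -> circle R) (a : X) :
  {for a, continuous g} -> {for a, continuous h} ->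
  {for a, continuous (fun y => upd (g y) j (h y))}.
Proof.
move=> cg ch; apply: continuous_torus => i.
rewrite (_ : (fun _ => _) = if i == j then h else (fun y => g y 0 i)).
  case: eqP => // _; apply: (continuous_comp (g := fun z => z 0 i)) => //.
  exact: continuous_coord.
by apply/funext => y; rewrite updE; case: eqP.
Qed.

Lemma continuous_torusDl z : continuous (fun w => z + w).
Proof.
move=> w; apply: continuous_torus => i.
rewrite (_ : (fun _ => _) = (fun y : torus R n => z 0 i + y 0 i)).
  by apply: continuous_circleD; [exact: cst_continuous | exact: continuous_coord].
by apply/funext => y; rewrite mxE.
Qed.

End TorusTopology.

Section BorelMeasure.
Variables (R : realType).

Lemma borel_open (X : ptopologicalType) (A : set X) :
  open A -> measurable (A : set (borel X)).
Proof. by move=> oA; exact: sub_sigma_algebra. Qed.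

Lemma compact_circle : compact [set: circle R].
Proof.
rewrite (_ : setT = (@to_circle R) @` `[0, 1]).
  apply: continuous_compact; last exact: segment_compact.
  by apply: continuous_subspaceT; exact: continuous_to_circle.
apply/seteqP; split=> // t _; exists (fpart t); last exact: fpartK.
by rewrite /= in_itv/= fpart_ge0 ltW// fpart_lt1.
Qed.

Lemma compact_torus n : compact [set: torus R n].
Proof.
rewrite (_ : setT = [set v : torus R n | forall i, [set: circle R] (v ord0 i)]).
  by apply: (@rV_compact (circle R) n (fun=> setT)) => i; exact: compact_circle.
by apply/seteqP; split.
Qed.

(** By compactness, finitely many translates of [V] cover the torus; if [V]
    were null, so would be the torus. *)
Lemma haar_open_gt0 n (mu : probability (borel (torus R n)) R) (V : set (torus R n)) :
  @is_haar R (torus R n) +%R mu -> open V -> V !=set0 -> (0 < mu V)%E.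
Proof.
move=> haar oV [v Vv].
rewrite lt0e measure_ge0 andbT; apply/eqP => mu0.
pose W (a : torus R n) := [set a + x | x in V].
have WE a : W a = (fun w => - a + w) @^-1` V.
  apply/seteqP; split=> [_ [x Vx <-]|w Vw] /=; first by rewrite addrA addNr add0r.
  by exists (- a + w) => //; rewrite addrA subrr add0r.
have oW a : open (W a).
  by rewrite WE; move: V oV {Vv mu0 W WE}; apply/continuousP; exact: continuous_torusDl.
have muW a : mu (W a) = 0%E by rewrite haar//; exact: borel_open.
have := @compact_torus n; rewrite compact_cover => /(_ _ setT W).
case=> [a _|x _|D _ cD]; first exact: oW.
  by exists (x - v) => //; exists v => //; rewrite subrK.
have : mu.-negligible (cover [set` D] W).
  rewrite /cover bigcup_fset; elim/big_ind: _ => [|A B nA nB|a _].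
  - exact: negligible_set0.
  - exact: (@negligibleU _ (borel (torus R n)) R mu).
  - have mW : measurable (W a : set (borel (torus R n))) by apply: borel_open; exact: oW.
    by apply/(negligibleP mu mW); exact: muW.
move=> [B [mB B0 cB]].
have : (1 <= mu B)%E.
  rewrite -(@probability_setT _ _ _ mu) le_measure ?inE//.
  by apply: subset_trans cB.
by rewrite B0 lee_fin ler10.
Qed.

End BorelMeasure.

(** * Additive functions on the unit interval *)

Section Additive.
Variable R : realType.

(** Positivity makes [p] monotone, and additivity gives its values at the
    multiples of [1 / (2 N)]; the graph is thus squeezed between two lines that
    differ by [O(1 / N)]. The slope is read at [1 / 2] because [1] is outside of
    the domain. *)
Lemma additive_unit_linear (p : R -> R) :
  (forall x, 0 <= x < 1 -> 0 <= p x) ->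
  (forall x y, 0 <= x -> 0 <= y -> x + y < 1 -> p (x + y) = p x + p y) ->
  forall x, 0 <= x < 1 -> p x = 2 * p 2^-1 * x.
Proof.
move=> p_ge0 pD x /andP[x0 x1]; set c := 2 * p 2^-1.
have c0 : 0 <= c by rewrite mulr_ge0// p_ge0//; lra.
have p_mono a b : 0 <= a -> a <= b -> b < 1 -> p a <= p b.
  move=> a0 ab b1; rewrite -(subrKC a b) pD ?subr_ge0//; last by rewrite subrKC.
  by rewrite lerDl p_ge0// subr_ge0 ab/=; lra.
have p0 : p 0 = 0 by have := pD 0 0; rewrite addr0 => /(_ _ _ _)/eqP; rewrite ?lexx ?ltr01//; lra.
have pMn a k : 0 <= a -> a *+ k < 1 -> p (a *+ k) = p a *+ k.
  move=> a0; elim: k => [|k IH ak]; first by rewrite !mulr0n.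
  rewrite mulrSr in ak *; rewrite pD ?mulrn_wge0// IH ?mulrSr//.
  by apply: le_lt_trans ak; rewrite lerDl.
have approx N : (0 < N)%N -> x + (2 * N%:R)^-1 < 1 ->
    `|p x - c * x| <= c * (2 * N%:R)^-1.
  set s := (2 * N%:R)^-1 => N0 xs.
  have N0R : (0 < N%:R :> R) by rewrite ltr0n.
  have s0 : 0 < s by rewrite invr_gt0 mulr_gt0.
  have sN : s *+ N = 2^-1.
    by rewrite -[LHS]mulr_natr /s; field; rewrite gt_eqF.
  have ps : p s = c * s.
    have : p s *+ N = p 2^-1 by rewrite -pMn ?sN ?(ltW s0)//; lra.
    rewrite -[LHS]mulr_natr /c => <-; rewrite /s.
    by field; rewrite gt_eqF.
  have xs0 : 0 <= x / s by rewrite divr_ge0// ltW.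
  have /andP[k1 k2] := truncn_itv xs0.
  set k := Num.truncn (x / s) in k1 k2.
  rewrite ler_pdivlMr// in k1; rewrite ltr_pdivrMr// in k2.
  have k3 : k.+1%:R * s <= x + s by rewrite -natr1 mulrDl mul1r lerD2r.
  have lo : c * (k%:R * s) <= p x.
    rewrite mulrCA -ps mulr_natl -pMn ?(ltW s0)// -mulr_natl.
      by apply: p_mono => //; rewrite mulr_ge0// ltW.
    exact: le_lt_trans k1 x1.
  have up : p x <= c * (k.+1%:R * s).
    have ks1 := le_lt_trans k3 xs.
    rewrite mulrCA -ps mulr_natl -pMn ?(ltW s0)// -mulr_natl//.
    by apply: p_mono => //; exact: ltW.
  rewrite ler_distl; apply/andP; split.
    apply: le_trans lo; rewrite -mulrBr ler_wpM2l// lerBlDr.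
    by rewrite -natr1 mulrDl mul1r in k2; exact: ltW.
  by apply: (le_trans up); rewrite -mulrDr ler_wpM2l.
apply/eqP; rewrite -subr_eq0 -normr_le0; apply/ler_addgt0Pr => e e0.
rewrite add0r.
have d0 : 0 < 1 - x by rewrite subr_gt0.
have q0 : 0 <= (1 - x)^-1 + c / e by rewrite addr_ge0// ?invr_ge0 ?divr_ge0// ltW.
have /andP[_ hN] := truncn_itv q0.
set N := (Num.truncn _).+1 in hN.
have N0R : (0 < N%:R :> R) by rewrite ltr0n.
have ce0 : 0 <= c / e by rewrite divr_ge0// ltW.
have N1 : (1 - x)^-1 < N%:R by lra.
have i0 : 0 < (1 - x)^-1 by rewrite invr_gt0.
have N2 : c / e < N%:R by lra.
have N3 : (2 * N%:R)^-1 < 1 - x.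
  by rewrite invf_plt ?posrE ?mulr_gt0//; lra.
apply: (le_trans (approx N _ _)) => //; first by lra.
rewrite ler_pdivrMr ?mulr_gt0//; rewrite ltr_pdivrMr// in N2.
nra.
Qed.
End Additive.

(** * Haar measure of slabs *)

Section FibreMeasure.
Variables (R : realType) (n : nat) (mu : probability (borel (torus R n)) R).
Hypothesis haar : @is_haar R (torus R n) +%R mu.
Variables (V : set (torus R n)) (j : 'I_n).
Hypothesis mV : measurable (V : set (borel (torus R n))).
Hypothesis Vupd : forall z t, V z -> V (upd z j t).

Definition slab (a b : R) : set (borel (torus R n)) :=
  [set z | V z /\ a < fpart (z 0 j) <= b].

Lemma open_coord_gt (a : R) : 0 <= a -> open [set z : torus R n | a < fpart (z 0 j)].
Proof.
move=> a0; have /continuousP h := @continuous_coord R n j.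
exact: (h _ (open_fpart_gt a0)).
Qed.

Lemma measurable_slab a b : 0 <= a -> 0 <= b -> measurable (slab a b).
Proof.
move=> a0 b0; rewrite (_ : slab a b = (V `&` [set z | a < fpart (z 0 j)]) `\`
    [set z | b < fpart (z 0 j)]).
  by apply: measurableD; [apply: measurableI => //|]; apply: borel_open; exact: open_coord_gt.
apply/seteqP; split=> z /=.
  by move=> [Vz /andP[az zb]]; split=> //; apply/negP; rewrite -leNgt.
by move=> [[Vz az] /negP]; rewrite -leNgt => zb; split=> //; rewrite az zb.
Qed.

Definition turn (t : circle R) : torus R n := \row_i (if i == j then t else 0).

Lemma turnE t z : turn t + z = upd z j (t + z 0 j).
Proof.
by apply/rowP => i; rewrite !mxE; case: eqP => [->//|_]; rewrite add0r.
Qed.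

Lemma turnK t : cancel (+%R (turn t)) (+%R (turn (- t))).
Proof.
move=> z; rewrite [LHS]turnE turnE; apply/rowP => i; rewrite !updE eqxx.
by case: eqP => // ->; rewrite addrA addNr add0r.
Qed.

(** Only slabs that do not cross the discontinuity of [fpart] are moved, whence
    the bound on [b + c]. *)
Lemma slab_turn a b c : 0 <= a -> 0 <= b -> 0 <= c -> b + c < 1 ->
  mu (slab (a + c) (b + c)) = mu (slab a b).
Proof.
move=> a0 b0 c0 bc; rewrite -(haar (turn (to_circle c)) (measurable_slab a0 b0)).
congr (mu _); apply/seteqP; split=> [z [Vz /andP[az zb]]|_ [z [Vz /andP[az zb]] <-]].
  have z1 := fpart_lt1 (z 0 j).
  exists (turn (- to_circle c) + z); last first.
    by rewrite -{1}(opprK (to_circle c)) turnK.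
  rewrite turnE; split; first exact: Vupd.
  rewrite updE eqxx -to_circleN addrC fpart_shift; last by apply/andP; split; lra.
  by apply/andP; split; lra.
have z0 := fpart_ge0 (z 0 j).
rewrite turnE; split; first exact: Vupd.
rewrite updE eqxx [to_circle c + _]addrC fpart_shift; last by apply/andP; split; lra.
by apply/andP; split; lra.
Qed.

Let p x := fine (mu (slab 0 x)).

Let muE A : measurable A -> mu A = (fine (mu A))%:E.
Proof. by move=> mA; rewrite fineK// fin_num_measure. Qed.

(** The slope of the additive function [p] is the total mass [mu V]: the slab
    ]0, 1/2] and its image by half a turn, which is ]1/2, 1[ together with the
    class of [0], partition [V]. This avoids showing that points are null. *)
Let p_half : fine (mu V) = 2 * p 2^-1.
Proof.
have h0 : (0 : R) <= 2^-1 by rewrite invr_ge0.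
have mS := measurable_slab (lexx 0) h0.
have mC : measurable (V `\` slab 0 2^-1 : set (borel (torus R n))) by apply: measurableD.
have VE : V = slab 0 2^-1 `|` (V `\` slab 0 2^-1).
  by rewrite setDUK// => z [].
have CE : V `\` slab 0 2^-1 = [set turn (to_circle 2^-1) + z | z in slab 0 2^-1].
  apply/seteqP; split=> [z [Vz nz]|_ [z [Vz /andP[z0 z1]] <-]].
    exists (turn (- to_circle 2^-1) + z); last first.
      by rewrite -{1}(opprK (to_circle 2^-1)) turnK.
    rewrite turnE; split; first exact: Vupd.
    have z0 := fpart_ge0 (z 0 j); have z1 := fpart_lt1 (z 0 j).
    rewrite updE eqxx; have [zl|zl] := ltP 2^-1 (fpart (z 0 j)).
      rewrite -to_circleN addrC fpart_shift; last by apply/andP; split; lra.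
      by apply/andP; split; lra.
    have {}z0 : fpart (z 0 j) = 0.
      apply/eqP; rewrite eq_le z0 andbT leNgt; apply/negP => zp.
      by apply: nz; split=> //; rewrite zp zl.
    rewrite -(fpartK (z 0 j)) z0 to_circle0 addr0.
    rewrite (_ : - to_circle 2^-1 = to_circle 2^-1).
      by rewrite to_circleK; apply/andP; split; lra.
    rewrite -to_circleN; apply/eq_to_circle.
    by rewrite (_ : - 2^-1 - 2^-1 = - 1 :> R) ?rpredN ?rpred1//; lra.
  rewrite turnE; split; first exact: Vupd.
  move=> [_]; rewrite updE eqxx -[z 0 j]fpartK -to_circleD.
  have [e|ne] := eqVneq (fpart (z 0 j)) 2^-1.
    rewrite e (_ : _ + _ = 1 :> R); last by lra.
    by rewrite to_circle_int// fpart0 ltxx.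
  have {z1}zl : fpart (z 0 j) < 2^-1 by rewrite lt_neqAle ne.
  rewrite to_circleK; last by apply/andP; split; lra.
  by move=> /andP[_]; lra.
have muC : mu (V `\` slab 0 2^-1) = mu (slab 0 2^-1).
  by rewrite -(haar (turn (to_circle 2^-1)) mS); congr (mu _); exact: CE.
rewrite {1}VE measureU//; last by rewrite setDE setICA setICr setI0.
by rewrite fineD ?fin_num_measure// mulr_natl mulr2n; congr (_ + fine _).
Qed.

(** The Haar measure of a set which is a product along coordinate [j] is a
    product. Only invariance under the rotations of coordinate [j] is used: it
    makes the measure of a slab additive in its width. *)
Lemma mu_slab (a b : R) : 0 <= a -> a <= b -> b < 1 ->
  mu (slab a b) = ((b - a)%:E * mu V)%E.
Proof.
move=> a0 ab b1; have mab := measurable_slab a0 (le_trans a0 ab).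
have ba0 : 0 <= b - a by rewrite subr_ge0.
have -> : mu (slab a b) = mu (slab 0 (b - a)).
  by rewrite -(@slab_turn 0 (b - a) a)// ?subrK ?add0r.
rewrite (muE (measurable_slab (lexx 0) ba0)) (muE mV) -EFinM p_half; congr (_%:E).
rewrite mulrC -[LHS]/(p (b - a)); apply: additive_unit_linear; last by apply/andP; split; lra.
  by move=> x _; rewrite fine_ge0.
move=> x y x0 y0 xy; have xy0 : 0 <= x + y by rewrite addr_ge0.
rewrite /p; have -> : slab 0 (x + y) = slab 0 x `|` slab x (x + y).
  apply/seteqP; split=> z /=.
    move=> [Vz /andP[z0 zxy]]; have [zx|xz] := leP (fpart (z 0 j)) x.
      by left; split=> //; rewrite z0 zx.
    by right; split=> //; rewrite xz zxy.
  by move=> [] [Vz /andP[z0 zx]]; split=> //; apply/andP; split; lra.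
rewrite (_ : slab x (x + y) = slab (0 + x) (y + x)) ?add0r 1?[y + x]addrC//.
have mx := measurable_slab (lexx 0) x0; have mxy := measurable_slab x0 xy0.
rewrite measureU//; last first.
  by rewrite -subset0 => z [[_ /andP[_ zx]] [_ /andP[xz _]]]; lra.
rewrite fineD ?fin_num_measure//; congr (_ + _).
by rewrite -(@slab_turn 0 y x)// ?add0r 1?[y + x]addrC.
Qed.
End FibreMeasure.

(** * Triangular homeomorphisms *)

Section Triangular.
Variables (R : realType) (n : nat) (mu : probability (borel (torus R n)) R).
Hypothesis haar : @is_haar R (torus R n) +%R mu.
Variables (f g : torus R n -> torus R n).
Hypotheses (f_cont : continuous f) (g_cont : continuous g).
Hypotheses (fK : cancel f g) (gK : cancel g f).
Hypothesis f_haar : preserves mu f.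

Definition agree (k : nat) (x y : torus R n) :=
  forall i : 'I_n, (i < k)%N -> x 0 i = y 0 i.

Hypothesis f_tri : forall (j : 'I_n) x y, agree j.+1 x y -> f x 0 j = f y 0 j.

Definition fibre (x : torus R n) (j : 'I_n) (t : circle R) := f (upd x j t) 0 j.

Lemma agree_upd x y (j : 'I_n) t : agree j x y -> agree j.+1 (upd x j t) (upd y j t).
Proof.
move=> xy i ij; rewrite !updE; case: eqP => // /eqP nij; apply: xy.
by rewrite ltn_neqAle -ltnS ij andbT.
Qed.

Lemma agree_updr x (j : 'I_n) t : agree j x (upd x j t).
Proof.
by move=> i ij; rewrite updE; case: eqP => // e; rewrite e ltnn in ij.
Qed.

Lemma fibre_agree x y (j : 'I_n) : agree j x y -> fibre x j = fibre y j.
Proof. by move=> xy; apply/funext => t; apply: f_tri; exact: agree_upd. Qed.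

Lemma continuous_fibre x j : continuous (fibre x j).
Proof.
move=> t; apply: (continuous_comp (f := fun t => f (upd x j t)) (g := fun z => z 0 j)).
  apply: continuous_comp; last exact: f_cont.
  by apply: continuous_upd; [exact: cst_continuous | exact: cvg_id].
exact: continuous_coord.
Qed.

(** The map induced by [f] on the first [k] coordinates is injective. This is
    proved by descending induction on [k], from the injectivity of [f]. At level
    [k + 1], injectivity says that the fibre maps in coordinate [k] are
    injective and that those over two different points with the same image have
    disjoint images. The fibre maps are then surjective, so this is possible
    only if there are no two such points. *)
Lemma agree_from_image k x y : agree k (f x) (f y) -> agree k x y.
Proof.
move: {2}(n - k)%N (leqnn (n - k)) => d.
elim: d k x y => [|d IH] k x y.
  rewrite leqn0 subn_eq0 => nk fxy.
  suff -> : x = y by [].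
  by apply: (can_inj fK); apply/rowP => i; apply: fxy; exact: leq_trans nk.
have [nk _|kn] := leqP n k.
  by apply: IH; move: nk; rewrite -subn_eq0 => /eqP ->.
move=> knd; pose j := Ordinal kn.
have {}IH x' y' : agree k.+1 (f x') (f y') -> agree k.+1 x' y'.
  by apply: IH; rewrite subnS -ltnS prednK// subn_gt0.
move=> fxy.
have agreeS x' y' s t : agree k (f x') (f y') -> fibre x' j s = fibre y' j t ->
    agree k.+1 (upd x' j s) (upd y' j t).
  move=> xy' e; apply: IH => i; rewrite ltnS leq_eqVlt => /predU1P[ik|ik].
    by have -> : i = j by apply: val_inj.
  have := xy' i ik; rewrite (@f_tri i x' (upd x' j s)); last first.
    by move=> l li; apply: agree_updr; exact: leq_trans ik.
  rewrite (@f_tri i y' (upd y' j t)) => [//|l li].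
  by apply: agree_updr; exact: leq_trans ik.
have inj x' : injective (fibre x' j).
  move=> s t /(@agreeS x' x' s t (fun _ _ => erefl)) /(_ j (ltnSn k)).
  by rewrite !updE eqxx.
have [s hs] := circle_inj_surj (@continuous_fibre x j) (inj x) (fibre y j 0).
have xy := agreeS x y s 0 fxy hs.
move=> i ik; have := xy i (ltnW ik); rewrite !updE.
by case: eqP => // e; move: ik; rewrite e ltnn.
Qed.

Lemma fibre_inj x j : injective (fibre x j).
Proof.
move=> s t e; have /agree_from_image : agree j.+1 (f (upd x j s)) (f (upd x j t)).
  move=> i; rewrite ltnS leq_eqVlt => /predU1P[ij|ij].
    by have -> : i = j by apply: val_inj.
  apply: f_tri => l li; rewrite !updE; case: eqP => // lj.
  by move: (leq_trans li ij); rewrite lj ltnn.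
by move=> /(_ j (ltnSn j)); rewrite !updE eqxx.
Qed.

(** The inverse homeomorphism is triangular too. *)
Lemma agree_g k z w : agree k z w -> agree k (g z) (g w).
Proof. by move=> zw; apply: agree_from_image; rewrite !gK. Qed.

(** If the fibre map over [x] sends [a, b] into an open arc [J], then so do, by
    compactness, the fibre maps over all points of an open neighbourhood [V] of
    [x] which is a cylinder in coordinate [j]. Thus [f] sends the slab of width
    [b - a] over [V] into the slab over [f V] with fibre [J]. The set [f V] is
    again a cylinder in coordinate [j], because the inverse of [f] is
    triangular, and has the same positive measure as [V]; comparing the measures
    of the two slabs gives the inequality. *)
Lemma fibre_expanding x j : expanding (fibre x j).
Proof.
move=> c a b al be a0 ab b1 al0 albe be1 hx.
pose J := [set t : circle R | al < fpart (t - c) < be].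
pose V := [set y | forall s, a <= s <= b -> J (fibre y j (to_circle s))].
have oJ : open J.
  have /continuousP h : continuous (fun t : circle R => t - c).
    by move=> t; apply: continuous_circleB; [exact: cvg_id | exact: cst_continuous].
  exact: (h _ (@open_fpart_lt R al be al0)).
have oV : open V.
  rewrite openE => y Vy; have /compact_near_coveringP := @segment_compact R a b.
  move=> /(_ _ (nbhs y) (fun y s => J (fibre y j (to_circle s))) _) H.
  apply: filterS (H _) => [z zab s sab|s /=]; first by apply: zab; rewrite /= in_itv.
  rewrite in_itv/= => sab.
  have cj : continuous (fun q : R * torus R n => fibre q.2 j (to_circle q.1)).
    move=> q; apply: (continuous_comp (f := fun q : R * torus R n =>
      f (upd q.2 j (to_circle q.1))) (g := fun z => z 0 j)).
      apply: continuous_comp; last exact: f_cont.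
      apply: continuous_upd; first exact: cvg_snd.
      apply: (continuous_comp (f := fst)); first exact: cvg_fst.
      exact: continuous_to_circle.
    exact: continuous_coord.
  have /continuousP h := cj.
  by have := h _ oJ; rewrite openE => /(_ (s, y)); apply; exact: Vy.
have Vagree y z : agree j y z -> V y -> V z.
  by move=> /fibre_agree yz Vy s sab; rewrite -yz; exact: Vy.
have Vupd z t : V z -> V (upd z j t) by apply: Vagree; exact: agree_updr.
pose gV := g @^-1` V.
have ogV : open gV by move/continuousP: g_cont; apply.
have gVupd z t : gV z -> gV (upd z j t).
  by apply: Vagree; apply: agree_g; exact: agree_updr.
(* [gV] is the image of [V] by [f]. *)
have mugV : mu gV = mu V.
  rewrite -(f_haar (borel_open ogV)); congr (mu _).
  by apply/funext => z; rewrite /gV /= fK.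
(* [S] is the slab over [gV] with fibre [J]; rotating it by [- c] makes it a
   slab ]al, be[ away from the discontinuity of [fpart]. *)
pose S0 : set (borel (torus R n)) := [set w | gV w /\ al < fpart (w 0 j) < be].
pose S : set (borel (torus R n)) := [set w | gV w /\ J (w 0 j)].
have oS0 : open (S0 : set (torus R n)).
  apply: openI => //; have /continuousP h := @continuous_coord R n j.
  exact: (h _ (@open_fpart_lt R al be al0)).
have oS : open (S : set (torus R n)).
  by apply: openI => //; have /continuousP h := @continuous_coord R n j; exact: h.
have SE : S = [set turn j c + w | w in S0].
  apply/seteqP; split=> [w [gw Jw]|_ [w [gw Jw] <-]].
    exists (turn j (- c) + w); last by rewrite -{1}(opprK c) turnK.
    by rewrite turnE; split; [exact: gVupd | rewrite updE eqxx addrC].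
  rewrite turnE; split; first exact: gVupd.
  by rewrite updE eqxx /J/= addrAC subrr add0r.
have muS : mu S = mu S0 by rewrite SE; exact: haar (borel_open oS0).
have muV0 : (0 < mu V)%E by apply: haar_open_gt0 => //; exists x.
have mab : measurable (slab V j a b).
  by apply: measurable_slab; rewrite ?(le_trans a0)//; exact: borel_open.
have malbe : measurable (slab gV j al be).
  by apply: measurable_slab; rewrite ?(le_trans al0)//; exact: borel_open.
have mS0 : measurable S0 by exact: borel_open oS0.
have mS : measurable S by exact: borel_open oS.
have mfS : measurable (f @^-1` S : set (borel (torus R n))).
  by apply: borel_open; move/continuousP: f_cont; exact.
have le1 : (mu (slab V j a b) <= mu (f @^-1` S))%E.
  rewrite le_measure ?inE// => z [Vz /andP[za zb]].
  split; first by rewrite /gV/= fK.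
  rewrite /= -(upd_id z j) -[f _ 0 j]/(fibre z j (z 0 j)) -(fpartK (z 0 j)).
  by apply: Vz; rewrite (ltW za).
have le2 : (mu S0 <= mu (slab gV j al be))%E.
  by rewrite le_measure ?inE// => z [gz /andP[za zb]]; split=> //; rewrite za ltW.
have := le_trans le1; rewrite f_haar ?muS; last exact: borel_open.
move=> /(_ _ le2); rewrite !mu_slab//; [|exact: borel_open..].
rewrite mugV -(@fineK _ (mu V)) ?fin_num_measure//; last exact: borel_open.
rewrite -!EFinM lee_fin ler_pM2r// fine_gt0// muV0 ltey_eq fin_num_measure//.
exact: borel_open.
Qed.
End Triangular.

(** * Constancy of the sign *)

Section SignConstancy.
Variables (R : realType) (n : nat) (f : torus R n -> torus R n) (j : 'I_n).
Hypothesis f_cont : continuous f.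
Hypothesis fibre_isometry : forall x,
  (forall t, fibre f x j t = t + fibre f x j 0) \/
  (forall t, fibre f x j t = - t + fibre f x j 0).

(** Distinguishes the two kinds of isometries: its value is 1/4 for a rotation
    and 3/4 for a reflection. *)
Let increment (x : torus R n) : R :=
  fpart (fibre f x j (to_circle 4^-1) - fibre f x j 0).

Let increment_plus x : (forall t, fibre f x j t = t + fibre f x j 0) ->
  increment x = 4^-1.
Proof. by move=> h; rewrite /increment h addrK to_circleK//; lra. Qed.

Let increment_minus x : (forall t, fibre f x j t = - t + fibre f x j 0) ->
  increment x = 3 / 4.
Proof.
move=> h; rewrite /increment h addrK -[RHS](@to_circleK R); last by lra.
congr fpart; rewrite -to_circleN; apply/eq_to_circle.
by rewrite (_ : _ - _ = - 1 :> R) ?rpredN ?rpred1//; lra.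
Qed.

Let continuous_increment : continuous increment.
Proof.
have cf t : continuous (fun x => fibre f x j t).
  move=> x; apply: (continuous_comp (f := fun x => f (upd x j t))
    (g := fun z : torus R n => z 0 j)); last exact: continuous_coord.
  apply: continuous_comp; last exact: f_cont.
  by apply: continuous_upd; [exact: cvg_id | exact: cst_continuous].
move=> x; apply: (continuous_comp
  (f := fun x => fibre f x j (to_circle 4^-1) - fibre f x j 0)).
  by apply: continuous_circleB; exact: cf.
apply: continuous_fpart; apply: contraTneq isT => e.
have : increment x = 0 by rewrite /increment e fpart0.
by case: (fibre_isometry x) => [/increment_plus|/increment_minus] ->; lra.
Qed.

(** The torus is path connected, and [increment] is continuous with values in a
    set of two reals, so it is constant. *)
Lemma fibre_sign_constant :
  (forall x t, fibre f x j t = t + fibre f x j 0) \/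
  (forall x t, fibre f x j t = - t + fibre f x j 0).
Proof.
(* The path from [0] to [x] that is linear in the representatives in
   [0, 1[ of the coordinates of [x]. *)
pose path (x : torus R n) (s : R) : torus R n :=
  \row_i to_circle (s * fpart (x 0 i)).
have path0 x : path x 0 = 0.
  by apply/rowP => i; rewrite !mxE mul0r to_circle0.
have path1 x : path x 1 = x.
  by apply/rowP => i; rewrite !mxE mul1r fpartK.
have cpath x : continuous (path x).
  move=> s; apply: continuous_torus => i.
  rewrite (_ : (fun _ => _) = (fun y : R => to_circle (y * fpart (x 0 i)))).
    apply: (continuous_comp (f := fun y : R => y * fpart (x 0 i))).
      by apply: mulrr_continuous.
    exact: continuous_to_circle.
  by apply/funext => y; rewrite mxE.
have same x : increment x = increment 0.
  pose u s := increment (path x s).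
  have cu : continuous u.
    by move=> s; apply: continuous_comp; [exact: cpath | exact: continuous_increment].
  have u12 s : u s <> 2^-1.
    by rewrite /u; case: (fibre_isometry (path x s)) => [/increment_plus|/increment_minus] ->; lra.
  have ivt : ~~ (Num.min (u 0) (u 1) <= 2^-1 <= Num.max (u 0) (u 1)).
    apply/negP => /(IVT ler01 (continuous_subspaceT cu)) [s _]; exact: u12.
  have u0E : u 0 = increment 0 by rewrite /u path0.
  have u1E : u 1 = increment x by rewrite /u path1.
  move: ivt; rewrite -u0E -u1E ge_min le_max u0E u1E.
  case: (fibre_isometry x) => [/increment_plus|/increment_minus] ->;
  case: (fibre_isometry 0) => [/increment_plus|/increment_minus] -> //;
  by move=> /negP[]; apply/andP; split; apply/orP; (left; lra) || (right; lra).
have [h0|h0] := fibre_isometry 0; [left|right] => x; have [h|h] := fibre_isometry x => //.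
  by move: (same x); rewrite (increment_plus h0) (increment_minus h); lra.
by move: (same x); rewrite (increment_plus h) (increment_minus h0); lra.
Qed.
End SignConstancy.

Section Padding.
Variable R : realType.

(** A section of [first_coords], when [k <= n]. It also makes sense for
    [k > n], where it forgets the last coordinates. *)
Definition pad k n (y : torus R k) : torus R n :=
  \row_i (if insub (val i) is Some l then y 0 l else 0).

Lemma continuous_pad k n : continuous (@pad k n).
Proof.
move=> y; apply: continuous_torus => i; rewrite /pad.
case e : (insub (val i) : option 'I_k) => [l|].
  rewrite (_ : (fun _ => _) = (fun y : torus R k => y 0 l)).
    exact: continuous_coord.
  by apply/funext => z; rewrite mxE e.
rewrite (_ : (fun _ => _) = cst 0); first exact: cst_continuous.
by apply/funext => z; rewrite mxE e.
Qed.

Lemma agree_pad k n (le_kn : (k <= n)%N) (x : torus R n) :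
  agree k x (pad n (first_coords le_kn x)).
Proof.
by move=> i ik; rewrite mxE insubT mxE; congr (x 0 _); apply: val_inj.
Qed.

Lemma agree_first_coords k n (le_kn : (k <= n)%N) (x y : torus R n) :
  agree k x y -> first_coords le_kn x = first_coords le_kn y.
Proof. by move=> xy; apply/rowP => i; rewrite !mxE; apply: xy; exact: (ltn_ord i). Qed.
End Padding.

Theorem proposition2p2p1 (R : realType) (n : nat)
  (mu1 : probability (borel (circle R)) R) (haar_mu1 : @is_haar R (circle R) +%R mu1)
  (mu : probability (borel (torus R n.+1)) R) (haar_mu : @is_haar R (torus R n.+1) +%R mu)
  (f : torus R n.+1 -> torus R n.+1)
  (h1 : circle R -> circle R)
  (h : forall j : 'I_n, torus R j.+2 -> circle R)
  (f_head : forall x, f x 0 ord0 = h1 (x 0 ord0))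
  (f_tail : forall x (j : 'I_n),
     f x 0 (lift ord0 j) =
     h j (@first_coords _ j.+2 n.+1 (ltn_ord (lift ord0 j)) x))
  (f_homeo : homeomorphism f) (f_haar : preserves mu f)
  (h1_homeo : homeomorphism h1) (h1_haar : preserves mu1 h1) :
  exists (alpha : R) (g : forall j : 'I_n, torus R j.+1 -> circle R)
         (eps : 'I_n.+1 -> int),
    [/\ 0 <= alpha < 1,
        forall j, continuous (g j),
        forall i, eps i = 1 \/ eps i = - 1 &
        forall x,
          f x 0 ord0 = x 0 ord0 *~ eps ord0 + to_circle alpha /\
          forall j : 'I_n,
            f x 0 (lift ord0 j) =
            x 0 (lift ord0 j) *~ eps (lift ord0 j) +
            g j (@first_coords _ j.+1 n.+1 (ltnW (ltn_ord (lift ord0 j))) x)].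
Proof.
have [f_cont [g [g_cont fK gK]]] := f_homeo.
have f_tri (j : 'I_n.+1) (x y : torus R n.+1) : agree j.+1 x y -> f x 0 j = f y 0 j.
  case: (unliftP ord0 j) => [k|] -> xy.
    by rewrite !f_tail (agree_first_coords _ xy).
  by rewrite !f_head xy.
have isometry j : (forall x t, fibre f x j t = t + fibre f x j 0) \/
    (forall x t, fibre f x j t = - t + fibre f x j 0).
  apply: fibre_sign_constant => // x; apply: expanding_injective_isometry.
  - exact: continuous_fibre.
  - exact: (fibre_inj f_cont fK f_tri).
  - exact: (fibre_expanding haar_mu f_cont g_cont fK gK f_haar f_tri).
pose eps (j : 'I_n.+1) : int :=
  if `[< forall x t, fibre f x j t = t + fibre f x j 0 >] then 1 else -1.
have fE x j : f x 0 j = x 0 j *~ eps j + fibre f x j 0.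
  rewrite -{1}(upd_id x j) -[LHS]/(fibre f x j (x 0 j)) /eps.
  case: asboolP => [->|nplus]; first by rewrite mulr1z.
  by case: (isometry j) => // ->; rewrite mulrN1z.
exists (fpart (f 0 0 ord0)).
exists (fun (j : 'I_n) y => fibre f (pad n.+1 y) (lift ord0 j) 0), eps.
split.
- by rewrite fpart_ge0 fpart_lt1.
- move=> j y; apply: (continuous_comp (f := fun y => f (upd (pad n.+1 y) (lift ord0 j) 0))
    (g := fun z : torus R n.+1 => z 0 (lift ord0 j))); last exact: continuous_coord.
  apply: continuous_comp; last exact: f_cont.
  by apply: continuous_upd; [exact: continuous_pad | exact: cst_continuous].
- by move=> j; rewrite /eps; case: ifP; [left|right].
- move=> x; split=> [|j]; rewrite fE; congr (_ + _).
    rewrite fpartK; apply: f_tri => i; rewrite ltnS leqn0 => /eqP i0.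
    by rewrite updE mxE ifT//; apply/eqP/val_inj.
  apply: (congr1 (fun phi => phi 0)); apply: (fibre_agree f_tri).
  exact: agree_pad.
Qed.
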